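(* Let an instance of the bi-objective BRT investment problem $\textsc{BRT}(\textsc{Linear}/Z=\infty/|M|=1)$ with unit costs $c_e=1$ for all $e\in E$ be given. Let $e_{(i)}$, $i\in\{1,\dots,n-1\}$, denote a sorting of the segments such that $\tilde u_{e_{(1)}}\ge\dots\ge\tilde u_{e_{(n-1)}}$. 1. If $v\in\{0,\dots,n-1\}$ and $F=\{e_{(i)}: i\in\{1,\dots,v\}\}$, then $(F,v)$ is an efficient solution. 2. If there is some $\bar i\in\{1,\dots,n-1\}$ such that $\tilde u_{e_j}\le\tilde u_{e_{j'}}$ for all $j\le j'\le\bar i$ and $\tilde u_{e_j}\ge\tilde u_{e_{j'}}$ for all $\bar i\le j\le j'$, then for each non-dominated point there is some efficient solution $(F,v)$ attaining it (i.e. the non-dominated point equals $(p(F),v)$) such that all segments in $F$ are connected. 3. The instance can be solved in polynomial time, i.e. the set of all non-dominated points can be computed in polynomial time.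
   Context: An instance (with a single municipality, $|M|=1$, whose budget share is $1$, and with no constraint on the number of connected components, ''$Z=\infty$'') consists of: a linear graph $G=(V,E)$ with $V=\{1,\dots,n\}$, $n\in\mathbb N_{\ge1}$ (stations) and $E=\{e_i=\{i,i+1\}: i\in\{1,\dots,n-1\}\}$ (segments); upgrade costs $c_e\in\mathbb N_{\ge1}$ for $e\in E$; a set of OD pairs $D\subseteq\{(i,j):i,j\in V,i\neq j\}$, where $W_d\subseteq E$ denotes the edge set of the unique path from $i$ to $j$ in $G$ for $d=(i,j)\in D$; numbers of potential passengers $a_d\in\mathbb N_{\ge1}$ for $d\in D$; and infrastructure improvements $u_e\in\mathbb R_{>0}$ for $e\in E$. In Linear, the number of newly attracted passengers for $F\subseteq E$ is $p(F)=\sum_{d\in D}a_d\cdot\frac{\sum_{e\in F\cap W_d}u_e}{\sum_{e\in W_d}u_e}=\sum_{e\in F}\tilde u_e$, where $\tilde u_e:=u_e\cdot\sum_{d\in D:\,e\in W_d}\frac{a_d}{\sum_{e'\in W_d}u_{e'}}$ for $e\in E$. A pair $(F,v)$ with $F\subseteq E$, $v\in\mathbb R_{\ge0}$ is feasible if $\sum_{e\in F}c_e\le v$. The problem is to maximize $p(F)$ and minimize $v$ over feasible $(F,v)$. A feasible $(F,v)$ is efficient, and $(p(F),v)$ is called non-dominated, if there is no feasible $(F',v')$ with $p(F')\ge p(F)$, $v'\le v$ and at least one inequality strict. ''All segments in $F$ are connected'' means that the subgraph consisting of the edges in $F$ and their incident nodes has at most one connected component.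
   Formalization: Part 1 additionally assumes that every segment of F lies on W_d for some OD pair d in D; otherwise it fails (n=2, D empty, v=1: (F,1) is dominated by (∅,0)). Polynomial time is counted as unit-cost steps on a real RAM, in n+|D|. *)

(* Defs.v *)
From HB Require Import structures.
From mathcomp Require Import all_boot all_order all_algebra all_fingroup.
From mathcomp Require Import boolp reals.

Set Implicit Arguments.
Unset Strict Implicit.
Unset Printing Implicit Defensive.

Import Order.TTheory GRing.Theory Num.Theory.
Local Open Scope ring_scope.

(* Stations 1, ..., n are represented by 'I_n, and segment e_i by its index in
   'I_n.-1; everything is numbered from 0, so segment k joins k and k.+1. *)
Definition ends (n : nat) (e : 'I_n.-1) : {set 'I_n} :=
  [set x : 'I_n | (val x == val e) || (val x == (val e).+1)].

Definition adj (n : nat) (F : {set 'I_n.-1}) : rel 'I_n :=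
  [rel x y | [exists e in F, ends e == [set x; y]]].

Definition incident (n : nat) (F : {set 'I_n.-1}) : {set 'I_n} :=
  \bigcup_(e in F) ends e.

Definition connected_segments (n : nat) (F : {set 'I_n.-1}) : bool :=
  (n_comp (adj F) (incident F) <= 1)%N.

Definition simple_path (n : nat) (x y : 'I_n) (p : seq 'I_n) : bool :=
  [&& path (adj [set: 'I_n.-1]) x p, uniq (x :: p) & last x p == y].

(* zip (x :: p) p lists the pairs of consecutive stations of x :: p. *)
Definition traverses (n : nat) (x : 'I_n) (p : seq 'I_n) (e : 'I_n.-1) : bool :=
  has (fun xy => ends e == [set xy.1; xy.2]) (zip (x :: p) p).

(* The edge set W_d of the path joining the two stations of d; simple paths in
   a linear graph are unique, so "some simple path" means "the path". *)
Definition route (n : nat) (d : 'I_n * 'I_n) : {set 'I_n.-1} :=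
  [set e | `[< exists2 p, simple_path d.1 d.2 p & traverses d.1 p e >]].

Record instance (R : realType) := Instance {
  stations : nat;
  stations_gt0 : (0 < stations)%N;
  cost : 'I_stations.-1 -> nat;
  cost_gt0 : forall e, (0 < cost e)%N;
  od : {set 'I_stations * 'I_stations};
  od_neq : forall d, d \in od -> d.1 != d.2;
  passengers : 'I_stations * 'I_stations -> nat;
  passengers_gt0 : forall d, d \in od -> (0 < passengers d)%N;
  improvement : 'I_stations.-1 -> R;
  improvement_gt0 : forall e, 0 < improvement e
}.

Notation segment I := ('I_(stations I).-1).

Section Problem.
Variables (R : realType) (I : instance R).
Implicit Types (F : {set segment I}) (e : segment I) (v : R).

Definition unit_costs : Prop := forall e, cost e = 1%N.

Definition attracted F : R :=
  \sum_(d in od I) (passengers d)%:R *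
    ((\sum_(e in F :&: route d) improvement e) /
     (\sum_(e in route d) improvement e)).

(* The weight written u with a tilde. *)
Definition utilde e : R :=
  improvement e *
  \sum_(d in od I | e \in route d)
    ((passengers d)%:R / \sum_(e' in route d) improvement e').

Definition feasible F v : Prop :=
  0 <= v /\ (\sum_(e in F) cost e)%N%:R <= v.

Definition efficient F v : Prop :=
  feasible F v /\
  ~ (exists F' v', [/\ feasible F' v',
       attracted F <= attracted F', v' <= v &
       attracted F < attracted F' \/ v' < v]).

Definition nondominated (y : R * R) : Prop :=
  exists F v, efficient F v /\ y = (attracted F, v).

Definition sorting (s : {perm segment I}) : Prop :=
  forall i j : segment I, (i <= j)%N -> utilde (s j) <= utilde (s i).

Definition best_segments (s : {perm segment I}) (v : nat) : {set segment I} :=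
  [set s i | i : segment I & (i < v)%N].

Definition unimodal : Prop :=
  exists m : segment I,
    (forall j k : segment I, (j <= k <= m)%N -> utilde j <= utilde k) /\
    (forall j k : segment I, (m <= j <= k)%N -> utilde k <= utilde j).

End Problem.

(* As the data are arbitrary real numbers, running time is measured on a real
   RAM: exact field operations and comparisons on reals at unit cost, and
   integer cells used for counters and addresses.  The memory consists of
   arrays A[0], A[1], ... of natural numbers and of reals; array names are
   constants of the program, indices are computed.  There is no integer
   multiplication and no rounding of reals to integers, so that big numbers
   cannot be used to hide exponentially much work in one step. *)
Inductive iexp : Type :=
| IConst of nat
| IGet of nat & iexp
| IAdd of iexp & iexp
| ISub of iexp & iexp.

Inductive rexp : Type :=
| RInt of iexp
| RGet of nat & iexp
| RAdd of rexp & rexp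
| RSub of rexp & rexp
| RMul of rexp & rexp
| RDiv of rexp & rexp.

Inductive bexp : Type :=
| ILe of iexp & iexp
| RLe of rexp & rexp
| BNot of bexp
| BAnd of bexp & bexp.

Inductive cmd : Type :=
| Skip
| ISet of nat & iexp & iexp
| RSet of nat & iexp & rexp
| Seq of cmd & cmd
| If of bexp & cmd & cmd
| While of bexp & cmd.

Record state (R : realType) := State {
  imem : nat -> nat -> nat;
  rmem : nat -> nat -> R
}.

Definition update (T : Type) (m : nat -> nat -> T) (A k : nat) (x : T) :
    nat -> nat -> T :=
  fun B j => if (B == A) && (j == k) then x else m B j.

Section Semantics.
Variable R : realType.
Implicit Type s : state R.

Fixpoint ieval s (a : iexp) : nat :=
  match a with
  | IConst k => k
  | IGet A a1 => imem s A (ieval s a1)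
  | IAdd a1 a2 => (ieval s a1 + ieval s a2)%N
  | ISub a1 a2 => (ieval s a1 - ieval s a2)%N
  end.

Fixpoint reval s (a : rexp) : R :=
  match a with
  | RInt a1 => (ieval s a1)%:R
  | RGet A a1 => rmem s A (ieval s a1)
  | RAdd a1 a2 => reval s a1 + reval s a2
  | RSub a1 a2 => reval s a1 - reval s a2
  | RMul a1 a2 => reval s a1 * reval s a2
  | RDiv a1 a2 => reval s a1 / reval s a2
  end.

Fixpoint beval s (b : bexp) : bool :=
  match b with
  | ILe a1 a2 => (ieval s a1 <= ieval s a2)%N
  | RLe a1 a2 => reval s a1 <= reval s a2
  | BNot b1 => ~~ beval s b1
  | BAnd b1 b2 => beval s b1 && beval s b2
  end.

(* exec s c t s' : started in memory s, the command c halts after t steps in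
   memory s'.  An assignment or a test is one step: a given program contains
   finitely many expressions, so counting the operations inside them would
   change t by a constant factor only. *)
Inductive exec : state R -> cmd -> nat -> state R -> Prop :=
| exec_skip s : exec s Skip 1 s
| exec_iset s A i a :
    exec s (ISet A i a) 1
      (State (update (imem s) A (ieval s i) (ieval s a)) (rmem s))
| exec_rset s A i a :
    exec s (RSet A i a) 1
      (State (imem s) (update (rmem s) A (ieval s i) (reval s a)))
| exec_seq s1 s2 s3 c1 c2 t1 t2 :
    exec s1 c1 t1 s2 -> exec s2 c2 t2 s3 ->
    exec s1 (Seq c1 c2) (t1 + t2) s3
| exec_if_true s s' b c1 c2 t :
    beval s b -> exec s c1 t s' -> exec s (If b c1 c2) t.+1 s'
| exec_if_false s s' b c1 c2 t :
    ~~ beval s b -> exec s c2 t s' -> exec s (If b c1 c2) t.+1 s'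
| exec_while_true s1 s2 s3 b c t1 t2 :
    beval s1 b -> exec s1 c t1 s2 -> exec s2 (While b c) t2 s3 ->
    exec s1 (While b c) (t1 + t2).+1 s3
| exec_while_false s b c :
    ~~ beval s b -> exec s (While b c) 1 s.

(* Integer arrays 0-4 hold the numbers of stations and of OD pairs, the costs,
   the origins, the destinations and the numbers of passengers; real array 0
   holds the improvements.  All other cells are 0. *)
Definition input (I : instance R) : state R :=
  let ds := enum (od I) in
  let es := enum (segment I) in
  State
    (fun A => nth 0%N (nth [::]
       [:: [:: stations I; #|od I|];
           [seq cost e | e <- es];
           [seq val d.1 | d <- ds];
           [seq val d.2 | d <- ds];
           [seq passengers d | d <- ds]] A))
    (fun A => nth 0 (nth [::] [:: [seq improvement e | e <- es]] A)).

(* The number of output points is in cell 0 of integer array 5; their first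
   and second coordinates are in real arrays 1 and 2. *)
Definition output (s : state R) : seq (R * R) :=
  [seq (rmem s 1 k, rmem s 2 k) | k <- iota 0 (imem s 5 0)].

(* Number of input cells, up to a constant factor. *)
Definition instance_size (I : instance R) : nat := (stations I + #|od I|)%N.

(* One program has to work for all instances of the class P. *)
Definition polytime_solvable (P : instance R -> Prop) : Prop :=
  exists (c : cmd) (C k : nat), forall I : instance R, P I ->
    exists (t : nat) (s : state R),
      [/\ exec (input I) c t s,
          (t <= C * instance_size I ^ k)%N &
          forall y : R * R, nondominated I y <-> y \in output s].

End Semantics.

(* Main.v *)
(* With unit costs p is additive with weights utilde, and v only bounds the
   number of segments, so a set of v segments is optimal as soon as none of its
   segments weighs less than a segment outside; it is efficient if moreover all
   its weights are positive.

   For unimodal weights with mode m, take among the optimal sets of a given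
   size one that minimises the total distance of its segments to m.  Replacing
   a segment by an unused one between it and m would lose no weight and reduce
   the distance, so the set contains everything between its segments and m.

   The non-dominated points are therefore (w_0 + ... + w_(k-1), k), where
   w_0 >= w_1 >= ... are the positive weights, and selection sort on the weights
   produces them all in quadratic time. *)
Require Import Defs.
From HB Require Import structures.
From mathcomp Require Import all_boot all_order all_algebra all_fingroup.
From mathcomp Require Import boolp reals zify.

Set Implicit Arguments.
Unset Strict Implicit.
Unset Printing Implicit Defensive.

Import Order.TTheory GRing.Theory Num.Theory.
Local Open Scope ring_scope.

(** * Sets of heaviest elements *)

Definition top_set (R : realDomainType) (T : finType) (u : T -> R)
    (G : {set T}) : Prop :=
  forall x y, x \in G -> y \notin G -> u y <= u x.

(** The largest weight [t] outside [G] separates: weights in [H :\: G] are at most [t], those in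
    [G :\: H] at least [t], and the former set is not larger. The default 0 of [t], for full [G], is
    harmless since weights are nonnegative. *)
Lemma top_set_max (R : realDomainType) (T : finType) (u : T -> R)
    (G H : {set T}) :
  (forall x, 0 <= u x) -> top_set u G -> (#|H| <= #|G|)%N ->
  \sum_(x in H) u x <= \sum_(x in G) u x.
Proof.
move=> u0 topG leHG.
pose t := \big[Num.max/0]_(x in ~: G) u x.
have t_ge0 : 0 <= t by rewrite /t; apply: bigmax_ge_id.
have t_out y : y \notin G -> u y <= t.
  by move=> yG; apply: (le_bigmax_cond _ u); rewrite inE.
have t_in x : x \in G -> t <= u x.
  move=> xG; apply: bigmax_le => // y.
  by rewrite inE; apply: topG.
rewrite (big_setID G) /= [leRHS](big_setID H) /= setIC lerD2l.
apply: (@le_trans _ _ (t *+ #|H :\: G|)).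
  by rewrite -sumr_const; apply: ler_sum => x; rewrite inE => /andP[/t_out].
apply: (@le_trans _ _ (t *+ #|G :\: H|)).
  by rewrite ler_wpMn2l // !cardsD [in leqRHS]setIC leq_sub2r.
by rewrite -sumr_const; apply: ler_sum => x; rewrite inE => /andP[_ /t_in].
Qed.

(** Some element of [G] is missing from [H]; adding it gains a positive weight, and the enlarged set
    is still no larger than [G]. *)
Lemma top_set_lt (R : realDomainType) (T : finType) (u : T -> R)
    (G H : {set T}) :
  (forall x, 0 <= u x) -> top_set u G -> (forall x, x \in G -> 0 < u x) ->
  (#|H| < #|G|)%N -> \sum_(x in H) u x < \sum_(x in G) u x.
Proof.
move=> u0 topG posG ltHG.
have /subsetPn[e eG eH] : ~~ (G \subset H).
  by apply: contraL ltHG => /subset_leq_card; rewrite -leqNgt.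
apply: (@lt_le_trans _ _ (\sum_(x in e |: H) u x)).
  by rewrite big_setU1 //= ltrDr posG.
by apply: top_set_max => //; rewrite cardsU1 eH.
Qed.

(** * Efficient solutions under unit costs *)

Lemma attractedE (R : realType) (I : instance R) (F : {set segment I}) :
  attracted F = \sum_(e in F) utilde e.
Proof.
rewrite /attracted /utilde.
under [RHS]eq_bigr => e _ do rewrite mulr_sumr.
rewrite (exchange_big_dep (mem (od I))) /=; last by move=> e d _ /andP[].
apply: eq_bigr => d dD.
rewrite mulrA mulrAC mulrC mulr_suml; apply: eq_big => [e|e _].
  by rewrite inE dD.
by rewrite mulrA.
Qed.

Lemma route_weight_ge0 (R : realType) (I : instance R)
    (d : 'I_(stations I) * 'I_(stations I)) :
  0 <= \sum_(e in route d) @improvement R I e.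
Proof. by apply: sumr_ge0 => e _; apply/ltW/improvement_gt0. Qed.

Lemma utilde_ge0 (R : realType) (I : instance R) (e : segment I) :
  0 <= utilde e.
Proof.
rewrite mulr_ge0 ?(ltW (improvement_gt0 _)) // sumr_ge0 // => d _.
by rewrite divr_ge0 // route_weight_ge0.
Qed.

Lemma utilde_gt0 (R : realType) (I : instance R) (e : segment I)
    (d : 'I_(stations I) * 'I_(stations I)) :
  d \in od I -> e \in route d -> 0 < utilde e.
Proof.
move=> dD ed; rewrite mulr_gt0 ?improvement_gt0 //.
rewrite (bigD1 d) ?dD //= ltr_pwDl //.
  rewrite divr_gt0 ?ltr0n ?passengers_gt0 //.
  rewrite (bigD1 e) //= ltr_pwDl ?improvement_gt0 //.
  by rewrite sumr_ge0 // => e' _; apply/ltW/improvement_gt0.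
by rewrite sumr_ge0 // => d' _; rewrite divr_ge0 // route_weight_ge0.
Qed.

Lemma feasibleE (R : realType) (I : instance R) (F : {set segment I}) (v : R) :
  unit_costs I -> feasible F v <-> #|F|%:R <= v.
Proof.
move=> uc; rewrite /feasible (eq_bigr (fun=> 1%N)) ?sum1_card //.
by split=> [[]|le_v] //; split=> //; apply: le_trans le_v.
Qed.

Lemma efficient_top_set (R : realType) (I : instance R) (G : {set segment I}) :
  unit_costs I -> top_set (@utilde R I) G ->
  (forall e, e \in G -> 0 < utilde e) -> efficient G #|G|%:R.
Proof.
move=> uc topG posG; split; first exact/feasibleE.
case=> F [v [/feasibleE-/(_ uc) leFv]]; rewrite !attractedE => leGF lev.
have leFG : (#|F| <= #|G|)%N by rewrite -(ler_nat R); apply: le_trans lev.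
have leS := top_set_max (@utilde_ge0 R I) topG leFG.
case=> [|ltv]; first by rewrite ltNge leS.
have : (#|F| < #|G|)%N by rewrite -(ltr_nat R); apply: le_lt_trans ltv.
by move/(top_set_lt (@utilde_ge0 R I) topG posG); rewrite ltNge leGF.
Qed.

(** Any slack in [v] could be given up without changing [F]. *)
Lemma efficient_cost (R : realType) (I : instance R) (F : {set segment I})
    (v : R) :
  unit_costs I -> efficient F v -> v = #|F|%:R.
Proof.
move=> uc [/feasibleE-/(_ uc) leFv ndom]; apply: contra_notP ndom => neq.
exists F, #|F|%:R; split=> //; first exact/feasibleE.
by right; rewrite lt_neqAle leFv andbT eq_sym; apply/eqP.
Qed.

Lemma efficient_max (R : realType) (I : instance R) (F H : {set segment I})
    (v : R) :
  unit_costs I -> efficient F v -> (#|H| <= #|F|)%N ->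
  attracted H <= attracted F.
Proof.
move=> uc eF leHF; have vE := efficient_cost uc eF; case: eF => _ ndom.
rewrite leNgt; apply/negP => ltFH; apply: ndom.
exists H, v; split=> //; [|exact: ltW|by left].
by apply/feasibleE => //; rewrite vE ler_nat.
Qed.

(** Dropping a segment of weight 0 would lower the cost and keep all passengers. *)
Lemma efficient_utilde_gt0 (R : realType) (I : instance R)
    (F : {set segment I}) (v : R) (e : segment I) :
  unit_costs I -> efficient F v -> e \in F -> 0 < utilde e.
Proof.
move=> uc eF eFe; have vE := efficient_cost uc eF; case: eF => _ ndom.
rewrite lt_neqAle utilde_ge0 andbT; apply/negP => /eqP u0; apply: ndom.
have cF := cardsD1 e F; rewrite eFe in cF.
exists (F :\ e), #|F :\ e|%:R; split=> //; first exact/feasibleE.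
- by rewrite !attractedE (big_setD1 e) //= -u0 add0r.
- by rewrite vE ler_nat cF leqnSn.
- by right; rewrite vE ltr_nat cF.
Qed.

Lemma efficient_swap (R : realType) (I : instance R) (F H : {set segment I})
    (v : R) :
  efficient F v -> feasible H v -> attracted H = attracted F -> efficient H v.
Proof.
move=> [_ ndom] fH eqHF; split=> //; apply: contra_not ndom.
by rewrite eqHF.
Qed.

Lemma best_segments_efficient (R : realType) (I : instance R)
    (s : {perm segment I}) (v : nat) :
  unit_costs I -> sorting s -> (v <= (stations I).-1)%N ->
  (forall e, e \in best_segments s v -> 0 < utilde e) ->
  efficient (best_segments s v) v%:R.
Proof.
move=> uc srt lev pos.
have memB i : (s i \in best_segments s v) = (i < v)%N.
  by rewrite (mem_imset _ _ (@perm_inj _ s)) inE.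
have cB : #|best_segments s v| = v.
  rewrite card_imset; last exact: perm_inj.
  have widen_inj : injective (widen_ord lev).
    by move=> i j /(congr1 val) /= /val_inj.
  rewrite -[RHS](card_ord v) -(card_imset 'I_v widen_inj).
  apply: eq_card => i; rewrite inE; apply/idP/imsetP => [ltiv|[j _ ->]].
    by exists (Ordinal ltiv) => //; apply: val_inj.
  exact: ltn_ord j.
suff /efficient_top_set-/(_ uc pos) : top_set (@utilde R I) (best_segments s v).
  by rewrite cB.
move=> x y; rewrite -[x](permKV s) -[y](permKV s) !memB -leqNgt => ltx ley.
by apply: srt; apply: leq_trans ley; apply: ltnW.
Qed.

(** * Routes and connectivity in a linear graph *)

Lemma ends_eq (n : nat) (e : 'I_n.-1) (x y : 'I_n) :
  (ends e == [set x; y]) =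
  ((x == e :> nat) && (y == e.+1 :> nat)) ||
  ((x == e.+1 :> nat) && (y == e :> nat)).
Proof.
apply/eqP/idP => [eE|].
  have lt1 : (e.+1 < n)%N by have := ltn_ord e; rewrite ltn_predRL.
  have memE (z : 'I_n) : ((z == e :> nat) || (z == e.+1 :> nat)) =
      (z == x) || (z == y).
    by move/setP: eE => /(_ z); rewrite !inE.
  (* Membership at the four stations [x], [y], [e] and [e.+1] already decides the matter by linear
     arithmetic. *)
  have := memE x; have := memE y; rewrite !eqxx orbT.
  have := memE (Ordinal (ltnW lt1)); have := memE (Ordinal lt1).
  rewrite -!val_eqE /= !eqxx orbT; lia.
move=> xy; apply/setP => z; rewrite !inE -!val_eqE /=; lia.
Qed.

Lemma adj_sym (n : nat) (F : {set 'I_n.-1}) : symmetric (adj F).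
Proof. by move=> x y; apply: eq_existsb => e; rewrite setUC. Qed.

Lemma adj_connect_sym (n : nat) (F : {set 'I_n.-1}) : connect_sym (adj F).
Proof. exact/sym_connect_sym/adj_sym. Qed.

Lemma adj_consecutive (n : nat) (F : {set 'I_n.-1}) (x y : 'I_n) :
  adj F x y -> (y == x.+1 :> nat) || (x == y.+1 :> nat).
Proof. case/exists_inP => e _; rewrite ends_eq; lia. Qed.

Lemma adj_connect (n : nat) (F : {set 'I_n.-1}) (x y : 'I_n) :
  (forall e : 'I_n.-1, (minn x y <= e < maxn x y)%N -> e \in F) ->
  connect (adj F) x y.
Proof.
wlog le_xy : x y / (x <= y)%N.
  move=> wl inF; case/orP: (leq_total x y) => le_xy; first exact: wl.
  by rewrite adj_connect_sym; apply: wl => // e; rewrite minnC maxnC;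
    apply: inF.
rewrite (minn_idPl le_xy) (maxn_idPr le_xy).
(* Induction on the index of [y]: a walk to the preceding station [k] is extended by segment [k],
   which ends in [y]. *)
elim: {y}(nat_of_ord y) {-2}y (erefl (nat_of_ord y)) le_xy
  => [|k IH] y yE le_xy inF.
  have -> : x = y by apply/val_inj => /=; lia.
  exact: connect0.
have [->|ne_xy] := eqVneq x y; first exact: connect0.
have ne : x != y :> nat by [].
have ltk : (k < n)%N by have := ltn_ord y; lia.
have ltk1 : (k < n.-1)%N by have := ltn_ord y; lia.
apply: (@connect_trans _ _ (Ordinal ltk)).
  apply: IH => //= [|e e_in]; first lia.
  by apply: inF; lia.
apply/connect1/exists_inP; exists (Ordinal ltk1).
  by apply: inF => /=; lia.
by rewrite ends_eq /=; lia.
Qed.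

(* A path in a linear graph cannot jump over a station. *)
Lemma path_gt (n : nat) (x z : 'I_n) (p : seq 'I_n) :
  path (adj [set: 'I_n.-1]) z p -> x \notin z :: p ->
  (x < z)%N = (x < last z p)%N.
Proof.
elim: p z => [|z' p IH] z //= /andP[/adj_consecutive zz' pth].
rewrite inE negb_or => /andP[xz xp]; rewrite -IH //.
move: xp; rewrite inE negb_or => /andP[xz' _].
move: xz xz'; rewrite -!val_eqE /=; lia.
Qed.

(** By [path_gt] the rest of the path stays on one side of [x], so the first segment extends the
    interval covered by the rest by one. *)
Lemma simple_path_traverses (n : nat) (x y : 'I_n) (p : seq 'I_n)
    (e : 'I_n.-1) :
  simple_path x y p -> traverses x p e = (minn x y <= e < maxn x y)%N.
Proof.
rewrite /simple_path /traverses => /and3P[pth unq /eqP <-] {y}.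
elim: p x pth unq => [|z p IH] x /=; first by move=> _ _; lia.
move=> /andP[/adj_consecutive xz pth] /andP[xp unq].
have gt := path_gt pth xp; have lastx : x != last z p :> nat.
  by apply: contraNneq xp => /val_inj ->; apply: mem_last.
rewrite {}IH //= ends_eq; lia.
Qed.

(** Replaces paths by intervals of indices, the form in which the program handles routes. *)
Lemma mem_route (n : nat) (d : 'I_n * 'I_n) (e : 'I_n.-1) :
  (e \in route d) = (minn d.1 d.2 <= e < maxn d.1 d.2)%N.
Proof.
rewrite inE; apply/asboolP/idP => [[p /simple_path_traverses->]//|e_in].
have /connectP[p pth dE] : connect (adj [set: 'I_n.-1]) d.1 d.2.
  by apply: adj_connect => f _; rewrite inE.
case/shortenP: pth dE => p' pth unq _ dE.
have sp : simple_path d.1 d.2 p' by rewrite /simple_path pth unq dE /=.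
by exists p' => //; rewrite (simple_path_traverses _ sp).
Qed.

(** Every incident station is joined within [F] to the left end of [m], so all component roots
    coincide. *)
Lemma connected_segments_star (n : nat) (F : {set 'I_n.-1}) (m : 'I_n.-1) :
  (forall e f : 'I_n.-1, e \in F -> (minn e m <= f <= maxn e m)%N -> f \in F) ->
  connected_segments F.
Proof.
move=> star; rewrite /connected_segments /n_comp_mem.
have ltm : (m < n)%N by have := ltn_ord m; lia.
have conn x : x \in incident F -> connect (adj F) x (Ordinal ltm).
  case/bigcupP => e eF; rewrite inE /= => xe.
  by apply: adj_connect => f /= xf; apply: (star e f eF); lia.
rewrite leqNgt; apply/negP => /card_gt1P[x [y []]].
rewrite !inE => /andP[/eqP rx xF] /andP[/eqP ry yF].
suff : fingraph.root (adj F) x = fingraph.root (adj F) y.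
  by rewrite rx ry => ->; rewrite eqxx.
apply/(fingraph.rootP (@adj_connect_sym n F)).
by apply: (connect_trans (conn x xF)); rewrite adj_connect_sym conn.
Qed.

Lemma unimodal_connected (R : realType) (I : instance R)
    (F : {set segment I}) (v : R) :
  unit_costs I -> unimodal I -> efficient F v ->
  exists H : {set segment I},
    [/\ efficient H v, attracted H = attracted F & connected_segments H].
Proof.
move=> uc [m [um1 um2]] eF.
pose dist (e : segment I) := (maxn e m - minn e m)%N.
pose good (H : {set segment I}) :=
  (#|H| == #|F|) && (attracted F <= attracted H).
have goodF : good F by rewrite /good eqxx lexx.
(* By efficiency of [F], every [good] set attracts exactly as many passengers as [F], so the
   distance can be minimised at no loss. *)
case: (arg_minnP (fun H : {set segment I} => \sum_(e in H) dist e)%N goodF).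
move=> H /andP[/eqP cH leFH] minH.
have eqFH : attracted H = attracted F.
  by apply/le_anti; rewrite leFH (efficient_max uc eF) ?cH.
exists H; split=> //.
  apply: (efficient_swap eF) => //; apply/feasibleE => //.
  by rewrite cH -(efficient_cost uc eF).
apply: (@connected_segments_star _ _ m) => e f eH fem.
apply/negPn/negP => fH.
have nef : e != f by apply: contraNneq fH => <-.
have nefv : e != f :> nat by [].
have fHe : f \notin H :\ e by rewrite !inE negb_and fH orbT.
have uef : utilde e <= utilde f.
  by case/orP: (leq_total e m) => em; [apply: um1|apply: um2]; lia.
have /minH : good (f |: H :\ e).
  rewrite /good cardsU1 fHe -cH (cardsD1 e H) eH eqxx /=.
  apply: le_trans leFH _; rewrite !attractedE big_setU1 //=.
  by rewrite (big_setD1 e eH) /= lerD2r.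
rewrite big_setU1 //= (big_setD1 e eH) /= leq_add2r /dist; lia.
Qed.

(** * Total correctness with time bounds *)

Definition runs (R : realType) (s : state R) (c : cmd) (T : nat)
    (Q : state R -> Prop) : Prop :=
  exists t s', [/\ exec s c t s', (t <= T)%N & Q s'].

Lemma runs_weaken (R : realType) (s : state R) (c : cmd) (T T' : nat)
    (Q Q' : state R -> Prop) :
  (T <= T')%N -> (forall s', Q s' -> Q' s') -> runs s c T Q -> runs s c T' Q'.
Proof.
move=> leT QQ' [t [s' [ex let_ Qs']]]; exists t, s'.
by split=> //; [apply: leq_trans leT|apply: QQ'].
Qed.

Lemma runs_skip (R : realType) (s : state R) (T : nat) (Q : state R -> Prop) :
  Q s -> runs s Skip T.+1 Q.
Proof. by exists 1%N, s; split=> //; apply: exec_skip. Qed.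

Lemma runs_iset (R : realType) (s : state R) (A : nat) (i a : iexp)
    (Q : state R -> Prop) :
  Q (State (update (imem s) A (ieval s i) (ieval s a)) (rmem s)) ->
  runs s (ISet A i a) 1 Q.
Proof. by move=> Qs; do 2 eexists; split; [apply: exec_iset| |apply: Qs]. Qed.

Lemma runs_rset (R : realType) (s : state R) (A : nat) (i : iexp) (a : rexp)
    (Q : state R -> Prop) :
  Q (State (imem s) (update (rmem s) A (ieval s i) (reval s a))) ->
  runs s (RSet A i a) 1 Q.
Proof. by move=> Qs; do 2 eexists; split; [apply: exec_rset| |apply: Qs]. Qed.

Lemma runs_seq (R : realType) (s : state R) (c1 c2 : cmd) (T1 T2 : nat)
    (Q : state R -> Prop) :
  runs s c1 T1 (fun s1 => runs s1 c2 T2 Q) -> runs s (Seq c1 c2) (T1 + T2) Q.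
Proof.
move=> [t1 [s1 [ex1 le1 [t2 [s2 [ex2 le2 Qs]]]]]].
by exists (t1 + t2)%N, s2; split; [apply: exec_seq ex1 ex2|apply: leq_add|].
Qed.

Lemma runs_if (R : realType) (s : state R) (b : bexp) (c1 c2 : cmd) (T : nat)
    (Q : state R -> Prop) :
  (beval s b -> runs s c1 T Q) -> (~~ beval s b -> runs s c2 T Q) ->
  runs s (If b c1 c2) T.+1 Q.
Proof.
move=> r1 r2; case: (boolP (beval s b)) => [bs|bs].
  have [t [s' [ex le Qs]]] := r1 bs; exists t.+1, s'.
  by split=> //; apply: exec_if_true.
have [t [s' [ex le Qs]]] := r2 bs; exists t.+1, s'.
by split=> //; apply: exec_if_false.
Qed.

Definition var (A : nat) : iexp := IGet A (IConst 0).

Definition for_loop (A : nat) (lo hi : iexp) (body : cmd) : cmd :=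
  Seq (ISet A (IConst 0) lo)
    (While (ILe (IAdd (var A) (IConst 1)) hi)
       (Seq body (ISet A (IConst 0) (IAdd (var A) (IConst 1))))).

Definition incr (R : realType) (A : nat) (s : state R) : state R :=
  State (update (imem s) A 0 (imem s A 0 + 1)%N) (rmem s).

(** Each round costs the body, the increment and the test, hence [T.+2]; the initial assignment and
    the failing test add 2. The bound [hi] is evaluated anew at every test, so the invariant has to
    fix its value. *)
Lemma runs_for (R : realType) (Inv : nat -> state R -> Prop) (A : nat)
    (lo hi : iexp) (body : cmd) (T a b : nat) (s : state R) :
  (a <= b)%N ->
  Inv a (State (update (imem s) A 0 (ieval s lo)) (rmem s)) ->
  (forall k s', Inv k s' -> imem s' A 0 = k /\ ieval s' hi = b) ->
  (forall k s', (a <= k < b)%N -> Inv k s' ->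
     runs s' body T (fun s'' => Inv k.+1 (incr A s''))) ->
  runs s (for_loop A lo hi body) ((b - a) * T.+2 + 2) (Inv b).
Proof.
move=> leab inv0 invE step.
have -> : ((b - a) * T.+2 + 2 = 1 + ((b - a) * T.+2).+1)%N by lia.
apply: runs_seq.
apply: runs_iset; move: inv0; set s0 := State _ _; move: s0 => {}s.
elim: {a}(b - a)%N {-2}a (erefl (b - a)%N) leab s step
  => [|n IH] a nE leab s step inv.
  have ab : a = b by lia.
  rewrite ab in inv *; have [kE bE] := invE _ _ inv.
  exists 1%N, s; split=> //; apply: exec_while_false => /=; rewrite kE bE; lia.
have [kE bE] := invE _ _ inv; have ltab : (a < b)%N by lia.
have [|t1 [s1 [ex1 le1 inv1]]] := step a s _ inv; first lia.
have [||t2 [s2 [ex2 le2 Qs]]] := IH a.+1 _ ltab (incr A s1) _ inv1.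
- lia.
- by move=> k s' k_in; apply: step; lia.
exists (t1 + 1 + t2).+1, s2; split=> //; last first.
  by rewrite -(subnSK ltab) mulSn; lia.
apply: exec_while_true ex2; first by rewrite /= kE bE; lia.
by apply: exec_seq ex1 _; apply: exec_iset.
Qed.

(** * Computing the weights *)

Section Weights.
Variables (R : realType) (I : instance R).

Let orig k := imem (input I) 2 k.
Let dest k := imem (input I) 3 k.
Let imp j := rmem (input I) 0 j.

(** Written so that evaluating the loop bounds of the program gives these terms directly. *)
Definition lo_station (k : nat) : nat := (orig k - (orig k - dest k))%N.
Definition hi_station (k : nat) : nat := (orig k + (dest k - orig k))%N.
Definition od_weight (k : nat) : R :=
  \sum_(lo_station k <= j < hi_station k) imp j.
(** The summand of the [k]-th OD pair in the weight of segment [j]; being 0 off the route, it can be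
    summed over all pairs. *)
Definition od_share (k j : nat) : R :=
  if (lo_station k <= j < hi_station k)%N
  then imp j * ((imem (input I) 4 k)%:R / od_weight k) else 0.

Lemma nth_input_improvement (e : segment I) :
  rmem (input I) 0 e = improvement e.
Proof.
by rewrite /= (nth_map e) ?size_enum_ord // nth_ord_enum.
Qed.

Lemma sum_improvement (a b : nat) : (b <= (stations I).-1)%N ->
  \sum_(a <= j < b) imp j =
  \sum_(e < (stations I).-1 | (a <= e < b)%N) improvement e.
Proof.
move=> leb; rewrite (big_nat_widen _ _ _ _ _ leb) (big_nat_widenl _ 0) //.
rewrite big_mkord; apply: eq_big => [e|e _]; first by rewrite /= andbC.
exact: nth_input_improvement.
Qed.

Lemma input_od (d0 : 'I_(stations I) * 'I_(stations I)) (k : nat) :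
  (k < #|od I|)%N ->
  let d := nth d0 (enum (od I)) k in
  [/\ orig k = d.1, dest k = d.2 & imem (input I) 4 k = passengers d].
Proof.
by rewrite cardE => ltk /=; rewrite /orig /dest /=; split;
  rewrite (nth_map d0).
Qed.

Lemma od_stations (d0 : 'I_(stations I) * 'I_(stations I)) (k : nat) :
  (k < #|od I|)%N ->
  let d := nth d0 (enum (od I)) k in
  lo_station k = minn d.1 d.2 /\ hi_station k = maxn d.1 d.2.
Proof.
move=> /(input_od d0)[oE dE _] /=; rewrite /lo_station /hi_station oE dE.
set x := nat_of_ord _; set y := nat_of_ord _; move: x y => x y; lia.
Qed.

Lemma hi_station_le (k : nat) :
  (k < #|od I|)%N ->
  (lo_station k <= hi_station k <= (stations I).-1)%N.
Proof.
pose d0 := Ordinal (stations_gt0 I).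
move=> /(od_stations (d0, d0))[-> ->].
have := ltn_ord (nth (d0, d0) (enum (od I)) k).1.
have := ltn_ord (nth (d0, d0) (enum (od I)) k).2; lia.
Qed.

Lemma sum_od_share (e : segment I) :
  \sum_(0 <= k < #|od I|) od_share k e = utilde e.
Proof.
pose d0 := (Ordinal (stations_gt0 I), Ordinal (stations_gt0 I)).
rewrite /utilde mulr_sumr big_mkcondr /= -[RHS]big_enum /= (big_nth d0) -cardE.
apply: eq_big_nat => k /andP[_ ltk].
have [loE hiE] := od_stations d0 ltk; have [_ _ pE] := input_od d0 ltk.
have /andP[_ hi_le] := hi_station_le ltk.
rewrite /od_share mem_route -loE -hiE; case: ifP => // _.
rewrite /imp nth_input_improvement pE /od_weight sum_improvement //.
congr (_ * (_ / _)); by apply: eq_bigl => f; rewrite mem_route loE hiE.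
Qed.

Definition keeps_input (s : state R) : Prop :=
  [/\ imem s 0 =1 imem (input I) 0, imem s 2 =1 imem (input I) 2,
      imem s 3 =1 imem (input I) 3, imem s 4 =1 imem (input I) 4 &
      rmem s 0 =1 rmem (input I) 0].

End Weights.

(* Cell 0 of integer array 6 holds the current OD pair k, cell 0 of array 7 the
   segment.  Subtraction is truncated, so x - (x - y) is the minimum and
   x + (y - x) the maximum of x and y. *)
Definition for_od_segments (body : cmd) : cmd :=
  for_loop 7
    (ISub (IGet 2 (var 6)) (ISub (IGet 2 (var 6)) (IGet 3 (var 6))))
    (IAdd (IGet 2 (var 6)) (ISub (IGet 3 (var 6)) (IGet 2 (var 6)))) body.

(* Real array 3 receives the weights; cell 0 of real array 4 holds the total
   improvement on the route of the current OD pair. *)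
Definition weights_cmd : cmd :=
  for_loop 6 (IConst 0) (IGet 0 (IConst 1))
    (Seq (RSet 4 (IConst 0) (RInt (IConst 0)))
    (Seq (for_od_segments
            (RSet 4 (IConst 0) (RAdd (RGet 4 (IConst 0)) (RGet 0 (var 7)))))
         (for_od_segments
            (RSet 3 (var 7)
               (RAdd (RGet 3 (var 7))
                  (RMul (RGet 0 (var 7))
                     (RDiv (RInt (IGet 4 (var 6))) (RGet 4 (IConst 0))))))))).

(** Cell 0 of both output arrays must still be 0, as it already holds the point of the empty set. *)
Definition after_weights (R : realType) (I : instance R) (k : nat)
    (s : state R) : Prop :=
  [/\ keeps_input I s, rmem s 1 0 = 0, rmem s 2 0 = 0 &
      forall j, rmem s 3 j = \sum_(0 <= i < k) od_share I i j].

Lemma runs_for_od (R : realType) (I : instance R) (k : nat)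
    (Inv : nat -> state R -> Prop) (body : cmd) (T : nat) (s : state R) :
  (k < #|od I|)%N ->
  (forall j s', Inv j s' -> [/\ keeps_input I s', imem s' 6 0 = k &
     imem s' 7 0 = j]) ->
  keeps_input I s -> imem s 6 0 = k ->
  Inv (lo_station I k)
    (State (update (imem s) 7 0 (lo_station I k)) (rmem s)) ->
  (forall j s', (lo_station I k <= j < hi_station I k)%N -> Inv j s' ->
     runs s' body T (fun s'' => Inv j.+1 (incr 7 s''))) ->
  runs s (for_od_segments body) ((stations I).-1 * T.+2 + 2)
    (Inv (hi_station I k)).
Proof.
move=> ltk invE [_ or de _ _] s6 inv0 step.
have /andP[lohi hile] := hi_station_le ltk.
apply: runs_weaken; last first.
- apply: (runs_for (Inv := Inv) (a := lo_station I k)) lohi _ _ step.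
  + by move: inv0; rewrite /= s6 or de.
  + move=> j s' /invE[[_ or' de' _ _] s'6 s'7]; split=> //=.
    by rewrite s'6 or' de'.
- by [].
- by rewrite leq_add2r leq_mul2r; apply/orP; right; lia.
Qed.

Lemma weights_cmd_correct (R : realType) (I : instance R) :
  runs (input I) weights_cmd (#|od I| * (6 * (stations I).-1 + 7) + 2)
    (after_weights I #|od I|).
Proof.
pose Inv k (s : state R) := after_weights I k s /\ imem s 6 0 = k.
apply: (@runs_weaken _ _ _ _ _ (Inv #|od I|)); [|by move=> s []|].
  exact: leqnn.
have -> : (#|od I| * (6 * (stations I).-1 + 7) =
           (#|od I| - 0) * (6 * (stations I).-1 + 5).+2)%N by lia.
apply: (runs_for (Inv := Inv)) => //.
- by split=> //; split=> // j; rewrite big_geq //= nth_nil.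
- by move=> k s [[[st _ _ _ _] _ _ _] s6] /=; rewrite s6 st.
move=> k s /= ltk [[ki r1 r2 r3] s6].
(* One step resets the total; each of the two passes over the route takes three steps per segment
   and two more. *)
have -> : (6 * (stations I).-1 + 5 =
  1 + (((stations I).-1 * 3 + 2) + ((stations I).-1 * 3 + 2)))%N by lia.
apply/runs_seq/runs_rset/runs_seq.
pose Inv1 j (s' : state R) := [/\ keeps_input I s', imem s' 6 0 = k,
  imem s' 7 0 = j & [/\ rmem s' 1 0 = 0, rmem s' 2 0 = 0,
   (forall j', rmem s' 3 j' = \sum_(0 <= i < k) od_share I i j') &
   rmem s' 4 0 = \sum_(lo_station I k <= i < j) rmem (input I) 0 i]].
apply: (runs_weaken (leqnn _) _ (runs_for_od (Inv := Inv1) ltk _ _ _ _ _))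
  => //.
- move=> s1 {r1 r2 r3 s6 ki} [ki s6 _ [r1 r2 r3 r4]].
  (* Cells on either side of the route have share 0, so the condition [j' < j] is right both before
     and after the loop. *)
  pose Inv2 j (s' : state R) := [/\ keeps_input I s', imem s' 6 0 = k,
    imem s' 7 0 = j & [/\ rmem s' 1 0 = 0, rmem s' 2 0 = 0,
     rmem s' 4 0 = od_weight I k &
     forall j', rmem s' 3 j' = \sum_(0 <= i < k) od_share I i j' +
        if (j' < j)%N then od_share I k j' else 0]].
  apply: (runs_weaken (leqnn _) _ (runs_for_od (Inv := Inv2) ltk _ _ _ _ _))
  => //.
  + move=> s2 [ki2 s26 _ [r21 r22 _ r23]]; split; last by rewrite /= s26 addn1.
    split=> // j; rewrite r23 big_nat_recr //=; congr (_ + _).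
    by case: ltnP => // hij; rewrite /od_share ifF //; lia.
  + by move=> j s' [].
  + split=> //; split=> // j'; rewrite r3.
    by case: ltnP => lij; rewrite /od_share ?ifF ?addr0 //; lia.
  move=> j s' j_in [ki2 s26 s27 [r21 r22 r24 r23]].
  apply: runs_rset; split=> //.
    by rewrite /= s27 addn1.
  split=> // j'; rewrite /update /= s27; have [_ _ _ p i0] := ki2.
  case: eqP => [->|nj].
    rewrite r23 ltnn ltnSn addr0 i0 p s26 r24 /od_share j_in //.
  by rewrite r23 ltnS [in RHS]leq_eqVlt; move/eqP/negPf: nj => ->.
- by move=> j s' [].
- split=> //; split=> //; by rewrite big_geq.
move=> j s' j_in [ki2 s26 s27 [r21 r22 r23 r24]].
apply: runs_rset; split=> //.
  by rewrite /= s27 addn1.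
split=> //; rewrite /update /= s27; have [_ _ _ _ i0] := ki2.
by rewrite big_nat_recr ?r24 ?i0 //; lia.
Qed.

(** * Selection sort on the weights *)

(* Cell 0 of integer array 9 receives the index of a largest weight. *)
Definition argmax_cmd : cmd :=
  Seq (ISet 9 (IConst 0) (IConst 0))
    (for_loop 7 (IConst 0) (ISub (IGet 0 (IConst 0)) (IConst 1))
       (If (RLe (RGet 3 (var 7)) (RGet 3 (var 9))) Skip
          (ISet 9 (IConst 0) (var 7)))).

(** Cell 0 of integer array 5 counts the points written so far; as the first one belongs to the
    empty set, it is also the size of the next set. The weight is zeroed only after it has been
    added. *)
Definition emit_cmd : cmd :=
  If (RLe (RGet 3 (var 9)) (RInt (IConst 0))) Skip
    (Seq (RSet 1 (var 5)
            (RAdd (RGet 1 (ISub (var 5) (IConst 1))) (RGet 3 (var 9))))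
    (Seq (RSet 2 (var 5) (RInt (var 5)))
    (Seq (RSet 3 (var 9) (RInt (IConst 0)))
         (ISet 5 (IConst 0) (IAdd (var 5) (IConst 1)))))).

Definition select_cmd : cmd :=
  Seq (ISet 5 (IConst 0) (IConst 1))
    (for_loop 8 (IConst 0) (ISub (IGet 0 (IConst 0)) (IConst 1))
       (Seq argmax_cmd emit_cmd)).

Definition solve_cmd : cmd := Seq weights_cmd select_cmd.

Definition positive_top_set (R : realType) (I : instance R)
    (G : {set segment I}) : Prop :=
  top_set (@utilde R I) G /\ (forall e, e \in G -> 0 < utilde e).

(* The set G of selected segments is recorded in memory by zeroing their
   weights; as only positive weights are selected, no segment is chosen
   twice. *)
Definition selected (R : realType) (I : instance R) (G : {set segment I})
    (s : state R) : Prop :=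
  [/\ imem s 0 0 = stations I, imem s 5 0 = #|G|.+1, positive_top_set G,
      (forall e : segment I, rmem s 3 e = if e \in G then 0 else utilde e) &
      (forall k, (k <= #|G|)%N -> exists H : {set segment I},
         [/\ #|H| = k, positive_top_set H, rmem s 1 k = attracted H &
             rmem s 2 k = k%:R])].

Lemma argmax_cmd_correct (R : realType) (I : instance R)
    (G : {set segment I}) (i : nat) (s : state R) :
  (0 < (stations I).-1)%N -> selected G s -> imem s 8 0 = i ->
  runs s argmax_cmd (4 * (stations I).-1 + 3)
    (fun s' => [/\ selected G s', imem s' 8 0 = i & exists2 e : segment I,
       imem s' 9 0 = e & forall f : segment I, rmem s' 3 f <= rmem s' 3 e]).
Proof.
move=> N0 sel s8; have -> : (4 * (stations I).-1 + 3 =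
  1 + (((stations I).-1 - 0) * 4 + 2))%N by lia.
apply/runs_seq/runs_iset.
pose Inv j (s' : state R) := [/\ selected G s', imem s' 8 0 = i,
  imem s' 7 0 = j & exists2 e : segment I, imem s' 9 0 = e &
    forall f : segment I, (f < j)%N -> rmem s' 3 f <= rmem s' 3 e].
apply: (runs_weaken (leqnn _) _ (runs_for (Inv := Inv) _ _ _ _)) => //.
- move=> s' [sel' s'8 _ [e s'9 maxe]]; split=> //; exists e => // f.
  exact: maxe.
(* Index 0 is a legitimate first choice, as there is at least one segment. *)
- by split=> //; exists (Ordinal N0).
- by move=> j s' [[s'0 _ _ _ _] _ s'7 _] /=; rewrite s'0 subn1.
move=> j s' /= ltj [sel' s'8 s'7 [e s'9 maxe]].
apply: runs_if => /=; rewrite s'7 s'9 => le_je.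
  apply: runs_skip; split=> //; first by rewrite /= s'7 addn1.
  exists e => // f; rewrite ltnS leq_eqVlt => /orP[/eqP->//|].
  exact: maxe.
apply: runs_iset; split=> //; rewrite /= /update /= s'7 ?addn1 //.
exists (Ordinal ltj) => // f; rewrite ltnS leq_eqVlt => /orP[/eqP->//|ltf] /=.
by apply: le_trans (maxe f ltf) _; apply/ltW; rewrite ltNge.
Qed.

Lemma positive_top_setU1 (R : realType) (I : instance R)
    (G : {set segment I}) (e : segment I) :
  positive_top_set G -> 0 < utilde e ->
  (forall f, f \notin G -> utilde f <= utilde e) ->
  positive_top_set (e |: G).
Proof.
move=> [top pos] e0 maxe; split=> [x y|x].
  rewrite !inE negb_or => /orP[/eqP->|xG] /andP[_ yG]; first exact: maxe.
  exact: top.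
by rewrite !inE => /orP[/eqP->|/pos].
Qed.

(** The cells of [G] are 0, so a maximum of 0 means that all segments outside [G] have weight 0,
    while a positive maximum is attained outside [G]. *)
Lemma emit_cmd_correct (R : realType) (I : instance R)
    (G : {set segment I}) (i : nat) (s : state R) (e : segment I) :
  selected G s -> imem s 8 0 = i -> imem s 9 0 = e ->
  (forall f : segment I, rmem s 3 f <= rmem s 3 e) ->
  runs s emit_cmd 5
    (fun s' => imem s' 8 0 = i /\
       ((selected G s' /\ forall f, f \notin G -> utilde f = 0) \/
        exists2 H : {set segment I}, #|H| = #|G|.+1 & selected H s')).
Proof.
move=> sel s8 s9 maxe; have [s0 s5 ptG s3 out] := sel.
apply: runs_if => /=; rewrite s9 => e0.
  apply: runs_skip; split=> //; left; split=> // f fG; apply/le_anti;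
    rewrite utilde_ge0 andbT.
  by have := le_trans (maxe f) e0; rewrite s3 (negPf fG).
move: e0; rewrite -ltNge s3; case: ifPn => [|eG e0]; first by rewrite ltxx.
apply: (runs_seq (T1 := 1) (T2 := 3)); apply: runs_rset.
apply: (runs_seq (T1 := 1) (T2 := 2)); apply: runs_rset.
apply: (runs_seq (T1 := 1) (T2 := 1)); apply: runs_rset.
apply: runs_iset; split=> //; right; exists (e |: G).
  by rewrite cardsU1 eG.
have ptU : positive_top_set (e |: G).
  apply: positive_top_setU1 => // f fG.
  by have := maxe f; rewrite !s3 (negPf fG) (negPf eG).
rewrite /selected /= /update /= !s5 s9 subn1 /= addn1 cardsU1 eG add1n.
split=> //.
- move=> f; rewrite in_setU1 -val_eqE /=; case: eqP => //= _; exact: s3.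
- move=> k; rewrite leq_eqVlt => /orP[/eqP->|ltk].
    rewrite eqxx; exists (e |: G); split=> //; first by rewrite cardsU1 eG.
    (* The previous point comes from a top set [H] that may differ from [G]; top sets of equal size
       have equal weight. *)
    have [H [cH ptH -> _]] := out _ (leqnn #|G|).
    rewrite s3 (negPf eG) !attractedE big_setU1 //= addrC; congr (_ + _).
    apply/le_anti; rewrite !top_set_max ?cH //.
    - exact: utilde_ge0.
    - by case: ptH.
    - exact: utilde_ge0.
    by case: ptG.
  by rewrite ltn_eqF //; apply: out.
Qed.

Lemma select_cmd_correct (R : realType) (I : instance R) (s : state R) :
  after_weights I #|od I| s ->
  runs s select_cmd ((stations I).-1 * (4 * (stations I).-1 + 10) + 3)
    (fun s' => exists2 G : {set segment I}, selected G s' &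
       forall e, e \notin G -> utilde e = 0).
Proof.
move=> [[st _ _ _ _] r1 r2 r3].
(* After [i] rounds at least [i] segments are selected or the positive weights are used up, so one
   round per segment suffices. *)
pose Inv i (s' : state R) := imem s' 8 0 = i /\ exists2 G : {set segment I},
  selected G s' & (i <= #|G|)%N \/ forall e, e \notin G -> utilde e = 0.
have -> : ((stations I).-1 * (4 * (stations I).-1 + 10) + 3 =
  1 + (((stations I).-1 - 0) * (4 * (stations I).-1 + 3 + 5).+2 + 2))%N by lia.
apply/runs_seq/runs_iset.
apply: (runs_weaken (leqnn _) _ (runs_for (Inv := Inv) _ _ _ _)) => //.
- move=> s' [_ [G sel lec]]; exists G => // e eG.
  case: lec => [lec|]; last by apply.
  suff /setP/(_ e) : G = setT by rewrite (negPf eG) inE.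
  by apply/eqP; rewrite eqEcard subsetT cardsT card_ord.
- split=> //; exists set0; last by left.
  split=> /=; rewrite /update /= ?cards0 //.
  + by split=> [x y|x]; rewrite inE.
  + by move=> e; rewrite inE r3 sum_od_share.
  move=> k; rewrite leqn0 => /eqP->; exists set0.
  rewrite cards0 attractedE big_set0; split=> //.
  by split=> [x y|x]; rewrite inE.
- by move=> i s' [s'8 [G [s'0 _ _ _ _] _]] /=; rewrite s'0 subn1.
move=> i s' /= lti [s'8 [G sel lec]].
apply: runs_seq.
have N0 : (0 < (stations I).-1)%N by lia.
apply: runs_weaken (argmax_cmd_correct N0 sel s'8) => // s1.
move=> [sel1 s18 [e s19 maxe]].
apply: runs_weaken (emit_cmd_correct sel1 s18 s19 maxe) => // s2 [s28 next].
split; first by rewrite /= s28 addn1.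
case: next => [[sel2 z]|[H cH sel2]]; first by exists G => //; right.
exists H => //; case: lec => [leiG|z]; first by left; rewrite cH.
(* Once all weights outside [G] are 0, [G] cannot grow: a new segment would have positive weight. *)
have /subsetPn[f fH /z f0] : ~~ (H \subset G).
  by apply: contraL (leqnn #|H|) => /subset_leq_card; rewrite -ltnNge cH.
by have [_ _ [_ /(_ f fH)]] := sel2; rewrite f0 ltxx.
Qed.

(** * Correctness of the output and the polynomial bound *)

(** An efficient set has only positive weights and hence lies in [G]; the top set recorded for its
    size attains the same point. Conversely, every recorded set is efficient. *)
Lemma selected_output (R : realType) (I : instance R) (G : {set segment I})
    (s : state R) :
  unit_costs I -> selected G s -> (forall e, e \notin G -> utilde e = 0) ->
  forall y : R * R, nondominated I y <-> y \in output s.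
Proof.
move=> uc [_ s5 _ _ out] z y; rewrite /output s5; split.
  case=> F [v [eF ->]].
  have leFG : (#|F| <= #|G|)%N.
    apply/subset_leq_card/subsetP => e eFe; apply/negPn/negP => /z u0.
    by have := efficient_utilde_gt0 uc eF eFe; rewrite u0 ltxx.
  apply/mapP; exists #|F|; first by rewrite mem_iota.
  have [H [cH [topH _] -> ->]] := out _ leFG.
  rewrite (efficient_cost uc eF); congr (_, _); apply/le_anti.
  rewrite (efficient_max uc eF) ?cH // andbT !attractedE.
  by apply: top_set_max; rewrite ?cH //; apply: utilde_ge0.
case/mapP => k; rewrite mem_iota add0n ltnS.
case/out=> [H [cH [topH posH] -> ->]] ->.
by exists H, k%:R; split=> //; rewrite -cH; apply: efficient_top_set.
Qed.

Lemma unit_costs_polytime (R : realType) : polytime_solvable (@unit_costs R).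
Proof.
(* With [N] segments and [D] OD pairs the two phases take at most [D * (6 * N + 7) + 2] and
   [N * (4 * N + 10) + 3] steps, together at most [30 * (N.+1 + D) ^ 2]. *)
exists solve_cmd, 30%N, 2%N => I uc.
have [t1 [s1 [ex1 le1 w]]] := weights_cmd_correct I.
have [t2 [s2 [ex2 le2 [G sel z]]]] := select_cmd_correct w.
exists (t1 + t2)%N, s2; split;
  [exact: exec_seq ex1 ex2| |exact: selected_output sel z].
apply: leq_trans (leq_add le1 le2) _; rewrite /instance_size.
have := stations_gt0 I; move: (stations I) #|od I| => [|N] D //= _; nia.
Qed.

(** A chosen segment on no route would have weight 0, and dropping it would save cost at no loss;
    hence the first claim asks that every segment of [F] lie on the route of some OD pair. *)
Theorem lemma12 (R : realType) :
  (forall I : instance R, unit_costs I ->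
     (forall (s : {perm segment I}) (v : nat) (F : {set segment I}),
        sorting s ->
        (v <= (stations I).-1)%N ->
        F = best_segments s v ->
        (forall e, e \in F -> exists2 d, d \in od I & e \in route d) ->
        efficient F v%:R)
     /\
     (unimodal I ->
        forall y : R * R, nondominated I y ->
        exists (F : {set segment I}) (v : R),
          [/\ efficient F v, y = (attracted F, v) & connected_segments F]))
  /\
  polytime_solvable (@unit_costs R).
Proof.
split; last exact: unit_costs_polytime.
move=> I uc; split=> [s v F srt lev -> cov|um y [F [v [eF ->]]]].
  apply: best_segments_efficient => // e /cov[d]; exact: utilde_gt0.
have [H [eH <- connH]] := unimodal_connected uc um eF.
by exists H, v.
Qed.
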